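(* Let $\mathcal{G}$ be a directed graph on $\{1,\dots,N\}$ with adjacency matrix $[a_{ij}]$ that contains a spanning tree. Consider the dynamics $$\dot S_i=\mu_1\sum_{j\in\mathcal{N}_i}a_{ij}(S_j-S_i),\qquad S_i(t)\in\mathbb{R}^{n\times n},\quad i=1,\dots,N.$$ Then, for any $\mu_1>0$ and any initial values $S_i(0)\in\mathbb{R}^{n\times n}$, $i=1,\dots,N$, the matrix signals $S_1(t),\dots,S_N(t)$ achieve consensus exponentially.
   Context: The graph is static; $a_{ij}>0$ if $(j,i)$ is an edge and $a_{ij}=0$ otherwise, and $\mathcal{N}_i=\{j:(j,i)\text{ is an edge}\}$. ''Contains a spanning tree'' means a directed spanning tree: some node has a directed path to every other node. ''Achieve consensus exponentially'' means that $S_i(t)-S_j(t)\to0$ exponentially as $t\to\infty$ for all $i,j$. *)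

(* Defs.v *)
From HB Require Import structures.
From mathcomp Require Import all_boot all_order all_algebra.
From mathcomp Require Import all_classical all_reals all_analysis.
Import Order.TTheory GRing.Theory Num.Theory.
Import numFieldNormedType.Exports.

Set Implicit Arguments.
Unset Strict Implicit.
Unset Printing Implicit Defensive.

Local Open Scope classical_set_scope.
Local Open Scope ring_scope.

(* [e j i] means that (j, i) is an edge, so [e] is read from source to target,
   whereas the weight of the edge (j, i) is the entry [a i j]. *)
Definition adjacency_matrix_of (R : realType) (N : nat) (e : rel 'I_N)
    (a : 'M[R]_N) : Prop :=
  forall i j : 'I_N, (e j i -> 0 < a i j) /\ (~~ e j i -> a i j = 0).

Definition in_neighbors (N : nat) (e : rel 'I_N) (i : 'I_N) : {set 'I_N} :=
  [set j | e j i]%SET.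

Definition contains_spanning_tree (N : nat) (e : rel 'I_N) : Prop :=
  exists r : 'I_N, forall i : 'I_N, i != r -> connect e r i.

(* Solutions live on [0, +oo[: two-sided derivatives are required only at
   t > 0, together with right-continuity at the initial time; the values of
   [S i] at negative times are irrelevant. *)
Definition consensus_dynamics (R : realType) (N n : nat) (e : rel 'I_N)
    (a : 'M[R]_N) (mu1 : R) (S0 : 'I_N -> 'M[R]_n) (S : 'I_N -> R -> 'M[R]_n)
    : Prop :=
  forall i : 'I_N,
    [/\ S i 0 = S0 i,
        S i t @[t --> 0^'+] --> S i 0
      & forall t : R, 0 < t ->
          is_derive t (1 : R) (S i)
            (mu1 *: \sum_(j in in_neighbors e i) a i j *: (S j t - S i t))].

Definition tends_to_0_exponentially (R : realType) (V : normedModType R)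
    (f : R -> V) : Prop :=
  exists C beta : R, 0 < beta /\
    forall t : R, 0 <= t -> `|f t| <= C * expR (- (beta * t)).

Definition achieve_consensus_exponentially (R : realType) (N n : nat)
    (S : 'I_N -> R -> 'M[R]_n) : Prop :=
  forall i j : 'I_N, tends_to_0_exponentially (fun t => S i t - S j t).

(* Main.v *)
Require Import Defs.
From HB Require Import structures.
From mathcomp Require Import all_boot all_order all_algebra.
From mathcomp Require Import all_classical all_reals all_analysis.
From mathcomp Require Import ring lra.
Import Order.TTheory GRing.Theory Num.Theory.
Import numFieldNormedType.Exports.

Local Open Scope classical_set_scope.
Local Open Scope ring_scope.

(* Every matrix entry solves the scalar system x_i' = sum_j w_ij (x_j - x_i), with
   w = mu1 a.  Extremal values never spread: a lower bound valid at time s stays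
   valid afterwards (minimum principle), and so does an upper bound by symmetry.
   If all x_i lie in [m, m + D] at time s, then up to the symmetry x -> -x the
   root satisfies x_r - m >= D / 2; this gap is propagated along the directed
   paths from the root, losing a factor that depends on w only, so that after one
   unit of time all the x_i lie in an interval of length rho D with rho < 1
   independent of the solution.  Iterating gives the exponential rate. *)

(** * One-sided minima and a Gronwall inequality *)

(** Minimality is asked on the left of [c] only, since the minimum may sit at the right end of a
    time interval. A positive derivative would make the slopes from the left positive. *)
Lemma is_derive_le0_at_left_min (R : realType) (f : R -> R) (s c l : R) :
  s < c -> (forall t, s <= t <= c -> f c <= f t) ->
  is_derive c (1 : R) f l -> l <= 0.
Proof.
move=> sc fmin /is_derive1_caratheodory[g [fE gc gl]].
rewrite leNgt; apply/negP => l0.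
have g0 : \forall z \near c^'-, 0 < g z.
  by apply: (cvgr_gt (g c)); [exact: cvg_at_left_filter|rewrite gl].
near c^'- => z.
have zc : z < c by [].
have sz : s <= z by near: z; exact: nbhs_left_ge.
have := fmin z; rewrite sz (ltW zc) => /(_ isT).
rewrite -subr_ge0 fE nmulr_lge0 ?subr_lt0// leNgt => /negP; apply.
by near: z.
Unshelve. all: by end_near. Qed.

(** Integrating factor: [expR (k * u) * (y u - eta)] is nondecreasing in [u]. *)
Lemma exp_growth_lower_bound (R : realType) (y dy : R -> R) (s t k eta : R) :
  s <= t -> {within `[s, t], continuous y} ->
  (forall u, s < u < t -> is_derive u (1 : R) y (dy u)) ->
  (forall u, s < u < t -> k * (eta - y u) <= dy u) ->
  expR (- (k * (t - s))) * (y s - eta) <= y t - eta.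
Proof.
move=> st yc yd dyk.
pose F u := expR (k * u) * (y u - eta).
have Fd u : s < u < t ->
    is_derive u (1 : R) F (expR (k * u) * (dy u - k * (eta - y u))).
  move=> /yd yu; rewrite /F.
  apply: is_derive_eq; rewrite /GRing.scale/=; ring.
have Fc : {within `[s, t], continuous F}.
  move=> u; apply: cvgM.
    apply: continuous_subspaceT => {}u.
    apply: (continuous_comp (g := expR)); last exact: continuous_expR.
    by apply: cvgM; [exact: cvg_cst|exact: cvg_id].
  by apply: cvgB; [exact: yc|exact: cvg_cst].
have Fle : F s <= F t.
  apply: (@ger0_derive1_le_cc _ F s t) => //; rewrite ?in_itv/= ?lexx ?st//.
  - by move=> u /[!in_itv]/= /Fd [].
  - move=> u; rewrite in_itv/= => ust.
    rewrite derive1E; have [_ ->] := Fd _ ust.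
    by rewrite mulr_ge0 ?expR_ge0// subr_ge0 dyk.
rewrite -(ler_pM2l (expR_gt0 (k * t))) mulrA -expRD.
by rewrite (_ : _ + _ = k * s); [exact: Fle|ring].
Qed.

(** * The scalar system and its minimum principle *)

(** It is applied with [w = mu1 *: a], which vanishes off the edges, so the sum may run over all
    nodes. *)
Definition scalar_consensus {R : realType} {N : nat} (w : 'M[R]_N)
    (x : 'I_N -> R -> R) : Prop :=
  forall i : 'I_N, x i t @[t --> 0^'+] --> x i 0 /\
    forall t : R, 0 < t ->
      is_derive t (1 : R) (x i) (\sum_j w i j * (x j t - x i t)).

Lemma scalar_consensus_affine (R : realType) (N : nat) (w : 'M[R]_N)
    (x : 'I_N -> R -> R) (k b : R) :
  scalar_consensus w x -> scalar_consensus w (fun i t => k * x i t + b).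
Proof.
move=> xw i; have [xi0 xid] := xw i; split.
  by apply: cvgD; [apply: cvgMr|exact: cvg_cst].
move=> t /xid xit; apply: is_derive_eq.
rewrite addr0 /GRing.scale/= mulr_sumr; apply: eq_bigr => j _; ring.
Qed.

Lemma scalar_consensus_continuous (R : realType) (N : nat) (w : 'M[R]_N)
    (x : 'I_N -> R -> R) (i : 'I_N) (s t : R) :
  scalar_consensus w x -> 0 <= s -> s < t ->
  {within `[s, t], continuous (x i)}.
Proof.
move=> xw s0 st; have [xi0 xid] := xw i.
have xc u : 0 < u -> {for u, continuous (x i)}.
  move=> /xid[xd _]; exact/differentiable_continuous/derivable1_diffP.
apply/continuous_within_itvP => //; split.
- move=> u; rewrite in_itv/= => /andP[su _]; apply: xc; exact: le_lt_trans su.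
- move: s0; rewrite le_eqVlt => /predU1P[<-//|s0].
  by apply: cvg_at_right_filter; exact: xc.
- by apply: cvg_at_left_filter; apply: xc; exact: le_lt_trans st.
Qed.

Lemma scalar_consensus_lower_bound (R : realType) (N : nat) (w : 'M[R]_N)
    (x : 'I_N -> R -> R) (s t m : R) :
  (forall i j, 0 <= w i j) -> scalar_consensus w x -> 0 <= s -> s <= t ->
  (forall i, m <= x i s) -> forall i, m <= x i t.
Proof.
move=> w0 xw s0; rewrite le_eqVlt => /predU1P[<-//|st] ms i.
suff H eps : 0 < eps -> m <= x i t + eps * (t - s).
  apply/ler_addgt0Pr => e e0.
  have := H (e / (t - s)); rewrite divfK ?subr_eq0 ?gt_eqF//; apply.
  by rewrite divr_gt0// subr_gt0.
move=> eps0.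
(* At a minimum of the tilted functions [z] reached after [s], the coupling is
   nonnegative, so the derivative is at least [eps] although it should be <= 0. *)
pose z j u := x j u + eps * (u - s).
have zc j : {within `[s, t], continuous (z j)}.
  move=> u; apply: cvgD; first exact: scalar_consensus_continuous xw s0 st u.
  apply: (@continuous_subspaceT _ _ _ (fun u => eps * (u - s))) => {}u.
  by apply: cvgMr; apply: cvgB; [exact: cvg_id|exact: cvg_cst].
(* One minimiser [c j] per node, then the best node [i0]: a minimum of [z] over all nodes and all
   times of [[s, t]]. *)
have /choice[c cP] : forall j, exists c, (s <= c <= t) /\
    forall u, s <= u <= t -> z j c <= z j u.
  move=> j; have [c /[!in_itv]/= cst cmin] := EVT_min (ltW st) (zc j).
  by exists c; split => // u ust; apply: cmin; rewrite in_itv.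
have [i0 _ i0min] := @Order.TotalTheory.arg_minP _ _ _ i xpredT
  (fun j => z j (c j)) isT.
have minz j u : s <= u <= t -> z i0 (c i0) <= z j u.
  by move=> /(proj2 (cP j)); apply: le_trans; exact: i0min.
apply: (@le_trans _ _ (z i0 (c i0))); last by apply: minz; rewrite lexx ltW.
have [/andP[+ cit] _] := cP i0; rewrite le_eqVlt => /predU1P[<-|sci].
  by rewrite /z subrr mulr0 addr0.
suff : \sum_j w i0 j * (x j (c i0) - x i0 (c i0)) + eps <= 0.
  rewrite leNgt => /negP[]; rewrite ltr_wpDl//; apply: sumr_ge0 => j _.
  rewrite mulr_ge0// subr_ge0 -(lerD2r (eps * (c i0 - s))).
  by apply: minz; rewrite (ltW sci).
apply: (is_derive_le0_at_left_min _ (z i0) s (c i0)) => //.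
  by move=> u /andP[su uc]; apply: minz; rewrite su (le_trans uc).
have xd := (proj2 (xw i0)) _ (le_lt_trans s0 sci).
apply: is_derive_eq.
by rewrite subr0 [_ *: _]mulr1.
Qed.

(** * Propagation of positivity along paths *)

(** Only the gain from [j] is kept, and the row sum of [i] is enlarged to a constant that is
    independent of [i] and positive even for [w = 0]. *)
Lemma sum_coupling_ge (R : realType) (N : nat) (w : 'M[R]_N) (y : 'I_N -> R)
    (i j : 'I_N) :
  (forall i j, 0 <= w i j) -> (forall i, 0 <= y i) ->
  w i j * y j - (1 + \sum_i \sum_j w i j) * y i <=
    \sum_j w i j * (y j - y i).
Proof.
move=> w0 y0; under [leRHS]eq_bigr do rewrite mulrBr.
rewrite sumrB; apply: lerB.
  by rewrite (bigD1 j)//= lerDl sumr_ge0// => k _; rewrite mulr_ge0.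
rewrite -mulr_suml ler_wpM2r// [X in 1 + X](bigD1 i)//= addrCA lerDl addr_ge0//.
by apply: sumr_ge0 => k _; exact: sumr_ge0.
Qed.

(* Each edge of the path uses half of the remaining delay [sigma], so that a unit
   time window is enough whatever the length of the path. *)
Lemma positivity_propagates (R : realType) (N : nat) (w : 'M[R]_N)
    (r i : 'I_N) (sigma : R) :
  (forall i j, 0 <= w i j) -> connect [rel j i | 0 < w i j] r i ->
  0 < sigma <= 1 ->
  exists2 delta, 0 < delta & forall x s h, scalar_consensus w x ->
    0 <= s -> (forall j, 0 <= x j s) -> 0 <= h <= x r s ->
    forall t, s + sigma <= t <= s + 1 -> delta * h <= x i t.
Proof.
move=> w0 /connectP[p]; elim/last_ind: p i sigma => [|p i' IH] i sigma.
  move=> _ -> /andP[sigma0 _].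
  (* At the root the derivative is at least [- k * x r], so a time at most 1 costs at most the
     factor [expR (- k)]. *)
  pose k := 1 + \sum_i \sum_j w i j.
  have k0 : 0 < k by rewrite ltr_wpDr// sumr_ge0// => ? _; exact: sumr_ge0.
  exists (expR (- k)); first exact: expR_gt0.
  move=> x s h xw s0 xs0 /andP[h0 hr] t /andP[st ts].
  have st' : s < t by rewrite (lt_le_trans _ st)// ltrDl.
  have := @exp_growth_lower_bound _ (x r) _ s t k 0 (ltW st')
    (scalar_consensus_continuous _ _ _ _ r _ _ xw s0 st')
    (fun u su => proj2 (xw r) u (le_lt_trans s0 (proj1 (andP su)))).
  rewrite !subr0 => H; apply: (le_trans _ (H _)).
    apply: ler_pM; rewrite ?expR_ge0// ler_expR lerN2 -[leRHS]mulr1.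
    by rewrite ler_pM2l// lerBlDl.
  move=> u /andP[su _]; rewrite sub0r mulrN.
  have xu0 j : 0 <= x j u.
    exact: (scalar_consensus_lower_bound _ _ _ _ s _ 0 w0 xw s0 (ltW su)).
  apply: le_trans (sum_coupling_ge _ _ w (x^~ u) r r w0 xu0).
  by rewrite lerDr mulr_ge0.
rewrite rcons_path last_rcons => /andP[rp /= wi] ->{i} /andP[sigma0 sigma1].
set j := last r p in wi.
have sigma20 : 0 < sigma / 2 by lra.
have [|d d0 dP] := IH j (sigma / 2) rp erefl; first lra.
pose k := 1 + \sum_i \sum_j w i j.
have k0 : 0 < k by rewrite ltr_wpDr// sumr_ge0// => ? _; exact: sumr_ge0.
pose q := expR (- (k * (sigma / 2))).
have q1 : q < 1 by rewrite expR_lt1 oppr_lt0 mulr_gt0.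
(* From [s + sigma / 2] on, [x j] stays above [d * h], so the derivative of [x i'] is at least
   [k * (eta - x i')] with [eta = w i' j / k * d * h]. The remaining time, at least [sigma / 2],
   lifts [x i'] to at least [(1 - q) * eta]. *)
exists ((1 - q) * (w i' j / k * d)).
  by rewrite mulr_gt0 ?subr_gt0// mulr_gt0// divr_gt0.
move=> x s h xw s0 xs0 /andP[h0 hr] t /andP[st ts].
set s1 := s + sigma / 2.
have s10 : 0 <= s1 by rewrite /s1; lra.
have s1t : s1 < t by rewrite /s1; lra.
have xu0 u : s <= u -> forall j, 0 <= x j u.
  by move=> su; apply: (scalar_consensus_lower_bound _ _ _ _ s _ 0 w0 xw s0 su).
set eta := w i' j / k * d * h.
have eta0 : 0 <= eta by rewrite !mulr_ge0// ?invr_ge0 ltW.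
have := @exp_growth_lower_bound _ (x i') _ s1 t k eta (ltW s1t)
    (scalar_consensus_continuous _ _ _ _ i' _ _ xw s10 s1t)
    (fun u su => proj2 (xw i') u (le_lt_trans s10 (proj1 (andP su)))).
have -> : (1 - q) * (w i' j / k * d) * h = eta - q * eta by rewrite /eta; ring.
move=> H; suff : - (q * eta) <= x i' t - eta by lra.
apply: (le_trans _ (H _)).
  set E := expR _.
  have Eq : E <= q.
    by rewrite ler_expR lerN2 ler_pM2l// /s1; lra.
  have E0 : 0 <= E by exact: expR_ge0.
  have x1 : 0 <= x i' s1 by apply: xu0; rewrite /s1; lra.
  have : E * eta <= q * eta by rewrite ler_wpM2r.
  have : 0 <= E * x i' s1 by rewrite mulr_ge0.
  lra.
move=> u /andP[su ut].
apply: le_trans (sum_coupling_ge _ _ w (x^~ u) i' j w0 (xu0 u _)); last first.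
  by move: su; rewrite /s1; lra.
rewrite -/k mulrBr lerD2r.
have -> : k * eta = w i' j * (d * h).
  by rewrite /eta; field; rewrite gt_eqF.
rewrite ler_pM2l//; apply: (dP x s h) => //; first by rewrite h0.
by move: su; rewrite /s1; lra.
Qed.

(** * Contraction of the spread and exponential decay *)

Lemma scalar_consensus_bounds (R : realType) (N : nat) (w : 'M[R]_N)
    (x : 'I_N -> R -> R) (s t m M : R) :
  (forall i j, 0 <= w i j) -> scalar_consensus w x -> 0 <= s -> s <= t ->
  (forall i, m <= x i s <= M) -> forall i, m <= x i t <= M.
Proof.
move=> w0 xw s0 st mM i.
rewrite (scalar_consensus_lower_bound _ _ _ _ _ _ _ w0 xw s0 st)/=; last first.
  by move=> j; have /andP[] := mM j.
have yw := scalar_consensus_affine _ _ _ _ (-1) M xw.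
have := scalar_consensus_lower_bound _ _ _ _ _ _ 0 w0 yw s0 st _ i.
rewrite mulN1r addrC subr_ge0; apply => j.
by rewrite mulN1r addrC subr_ge0; have /andP[] := mM j.
Qed.

Lemma scalar_consensus_contraction (R : realType) (N : nat) (w : 'M[R]_N)
    (r : 'I_N) :
  (forall i j, 0 <= w i j) ->
  (forall i, connect [rel j i | 0 < w i j] r i) ->
  exists2 rho, 0 < rho < 1 & forall x s m D, scalar_consensus w x ->
    0 <= s -> (forall i, m <= x i s <= m + D) ->
    exists m', forall i, m' <= x i (s + 1) <= m' + rho * D.
Proof.
move=> w0 tree.
(* With [sigma = 1] the time window shrinks to the single time [s + 1]. *)
have /choice[d dP] : forall i, exists d, 0 < d /\
    forall x s h, scalar_consensus w x ->
    0 <= s -> (forall j, 0 <= x j s) -> 0 <= h <= x r s ->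
    forall t, s + 1 <= t <= s + 1 -> d * h <= x i t.
  move=> i; have [|d d0 dP] := positivity_propagates _ _ _ _ _ 1 w0 (tree i).
    by rewrite ltr01 lexx.
  by exists d; split.
(* The initial value 1 of the minimum gives [delta <= 1], which keeps [1 - delta / 2] positive. *)
pose delta := \big[Num.min/1]_i d i.
have delta0 : 0 < delta.
  by apply: lt_bigmin => // i _; have [] := dP i.
have delta1 : delta <= 1 by exact: bigmin_le_id.
exists (1 - delta / 2); first by apply/andP; split; lra.
move=> x s m D xw s0 mD.
have D0 : 0 <= D by have := mD r; lra.
have ss1 : s <= s + 1 by rewrite lerDl.
have mD1 := scalar_consensus_bounds _ _ _ _ _ _ _ _ w0 xw s0 ss1 mD.
have pos y i : scalar_consensus w y -> (forall j, 0 <= y j s) ->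
    D / 2 <= y r s -> delta * (D / 2) <= y i (s + 1).
  move=> yw y0 yr; apply: (@le_trans _ _ (d i * (D / 2))).
    by rewrite ler_wpM2r ?divr_ge0// bigmin_le_cond.
  by apply: (proj2 (dP i)) yw s0 y0 _ _ _; rewrite ?lexx// yr divr_ge0.
(* If the root is in the upper half, [x - m] shows that the lower end rises; otherwise [m + D - x]
   shows that the upper end drops. *)
have [xr|xr] := leP (m + D / 2) (x r s).
  exists (m + delta * (D / 2)) => i.
  have yw := scalar_consensus_affine _ _ _ _ 1 (- m) xw.
  have H : delta * (D / 2) <= 1 * x i (s + 1) - m.
    by apply: (pos _ i yw) => [j|]; [have := mD j; lra|lra].
  have := mD1 i; lra.
exists m => i.
have yw := scalar_consensus_affine _ _ _ _ (-1) (m + D) xw.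
have H : delta * (D / 2) <= -1 * x i (s + 1) + (m + D).
  by apply: (pos _ i yw) => [j|]; [have := mD j; lra|lra].
have := mD1 i; lra.
Qed.

(** [K] and [beta] are chosen before the solution, so that one pair serves all matrix entries. *)
Lemma scalar_consensus_exponential (R : realType) (N : nat) (w : 'M[R]_N)
    (r : 'I_N) :
  (forall i j, 0 <= w i j) ->
  (forall i, connect [rel j i | 0 < w i j] r i) ->
  exists K beta, 0 < beta /\ forall x m D, scalar_consensus w x ->
    (forall i, m <= x i 0 <= m + D) -> forall t, 0 <= t ->
    forall i j, `|x i t - x j t| <= K * D * expR (- (beta * t)).
Proof.
move=> w0 tree.
have [rho /andP[rho0 rho1] rhoP] := scalar_consensus_contraction _ _ _ _ w0 tree.
(* The exponential is then [rho] to the power [t]; the factor [rho^-1] pays for rounding [t] down to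
   an integer. *)
exists rho^-1, (- ln rho); split; first by rewrite oppr_gt0 ln_lt0// rho0.
move=> x m D xw mD t t0 i j.
have D0 : 0 <= D by have := mD r; lra.
have step k : exists m', forall i, m' <= x i k%:R <= m' + rho ^+ k * D.
  elim: k => [|k [m' IH]]; first by exists m => l; rewrite expr0 mul1r.
  have [m'' H] := rhoP _ _ _ _ xw (ler0n _ k) IH.
  by exists m'' => l; rewrite -natr1 exprS -mulrA.
have [m' mk] := step (Num.truncn t).
have /andP[kt tk] := truncn_itv t0.
have mt := scalar_consensus_bounds _ _ _ _ _ _ _ _ w0 xw (ler0n _ _) kt mk.
have : `|x i t - x j t| <= rho ^+ (Num.truncn t) * D.
  rewrite ler_norml; have := mt i; have := mt j; lra.
move/le_trans; apply; rewrite mulrAC ler_wpM2r// mulNr opprK.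
rewrite mulrC ler_pdivlMr// -exprSr -{1}(lnK rho0) -expRM_natr ler_expR.
by rewrite ler_nM2l ?ln_lt0 ?rho0// ltW.
Qed.

(** * From matrices to entries and back *)

Lemma is_derive_mx_coord (R : realType) (m n : nat) (f : R -> 'M[R]_(m, n))
    (t : R) (l : 'M[R]_(m, n)) (k : 'I_m) (k' : 'I_n) :
  is_derive t (1 : R) f l -> is_derive t (1 : R) (fun u => f u k k') (l k k').
Proof.
move=> [fd fl].
have : (fun h => h^-1 *: (f (h *: (1 : R) + t) - f t)) h @[h --> 0^'] --> l.
  by rewrite -fl; exact: fd.
move=> /(@continuous_cvg _ _ _ _ _ _ (fun M : 'M[R]_(m, n) => M k k') _
  (@coord_continuous _ _ _ k k' l)) H.
have {}H : (h^-1 *: (f (h *: (1 : R) + t) k k' - f t k k')) @[h --> 0^']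
    --> l k k'.
  by apply: cvg_trans H; apply: near_eq_cvg; near=> h; rewrite /= !mxE.
split; [apply/cvg_ex; exists (l k k'); exact: H|exact: cvg_lim H].
Unshelve. all: by end_near. Qed.

(** The hypothesis [0 <= C] covers matrices without entries, whose norm is 0. *)
Lemma mx_norm_le (R : realType) (m n : nat) (A : 'M[R]_(m, n)) (C : R) :
  0 <= C -> (forall i j, `|A i j| <= C) -> `|A| <= C.
Proof.
move=> C0 AC; rewrite [leLHS]/Num.norm/= mx_normrE.
by apply: bigmax_le => // ij _; exact: AC.
Qed.

Theorem lemma3 (R : realType) (N n : nat) (e : rel 'I_N) (a : 'M[R]_N)
    (ha : adjacency_matrix_of e a) (he : contains_spanning_tree e)
    (mu1 : R) (hmu1 : 0 < mu1)
    (S0 : 'I_N -> 'M[R]_n) (S : 'I_N -> R -> 'M[R]_n)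
    (hS : consensus_dynamics e a mu1 S0 S) :
  achieve_consensus_exponentially S.
Proof.
have [r tree] := he.
pose w := mu1 *: a.
have we i j : e j i -> 0 < w i j.
  by move=> /(proj1 (ha i j)) aij; rewrite mxE mulr_gt0.
have wNe i j : ~~ e j i -> w i j = 0.
  by move=> /(proj2 (ha i j)) aij; rewrite mxE aij mulr0.
have w0 i j : 0 <= w i j.
  by have [/we/ltW|/wNe ->] := boolP (e j i).
have wtree i : connect [rel j i | 0 < w i j] r i.
  have [->|/tree] := eqVneq i r; first exact: connect0.
  by apply: connect_sub => j k /we wkj; exact: connect1.
have Sw k l : scalar_consensus w (fun i t => S i t k l).
  move=> i; have [_ Si0 Sid] := hS i; split.
    exact: (@continuous_cvg _ _ _ _ _ _ (fun M : 'M[R]_n => M k l) _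
      (@coord_continuous _ _ _ k l _) Si0).
  move=> t /Sid /(is_derive_mx_coord _ _ _ _ _ _ k l) Sd; apply: is_derive_eq.
  rewrite mxE summxE mulr_sumr [RHS](bigID (mem (in_neighbors e i)))/=.
  rewrite [X in _ = _ + X]big1 ?addr0; last first.
    by move=> j; rewrite inE => /wNe ->; rewrite mul0r.
  by apply: eq_bigr => j _; rewrite !mxE mulrA.
have [K [beta [beta0 KP]]] := scalar_consensus_exponential _ _ _ _ w0 wtree.
(* A single interval [[- B, B]], of length [B *+ 2], contains the initial entries of all nodes. *)
pose B := \sum_i `|S i 0|.
have SB i k l : - B <= S i 0 k l <= - B + B *+ 2.
  suff : `|S i 0 k l| <= B by rewrite ler_norml mulr2n addKr.
  apply: (@le_trans _ _ `|S i 0|).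
    by rewrite [leRHS]/Num.norm/= mx_normrE; exact: (le_bigmax _ _ (k, l)).
  by rewrite /B (bigD1 i)//= lerDl sumr_ge0.
(* The absolute value supplies the sign required by [mx_norm_le], as nothing is known about the sign
   of [K]. *)
move=> i j; exists (`|K * B *+ 2|), beta; split=> // t t0.
apply: mx_norm_le => [|k l]; first by rewrite mulr_ge0// expR_ge0.
rewrite 2!mxE; apply: le_trans (KP _ _ _ (Sw k l) (fun i => SB i k l) t t0 i j) _.
by rewrite ler_wpM2r ?expR_ge0// mulrnAr ler_norm.
Qed.
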